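(* Let $n$ be even and $k$ odd with $\frac{n}{2} \leqslant k < n-3$. Let $h = \frac{n-k-1}{2}$ and $p = \gcd(n,h)$. Then $$\mathrm{LB}(n,k) + \left\lceil \frac{p}{2}\right\rceil - 1 \leqslant rn_k(C_n) \leqslant \mathrm{LB}(n,k) + p - 1,$$ where $\mathrm{LB}(n,k) = \left\lceil \frac{3k+3-n}{2}\right\rceil \cdot \frac{n-2}{2} + k - \frac{n}{2} + 1$. Moreover, if $\frac{n}{2} \notin \langle h \rangle$, where $\langle h\rangle$ is the subgroup of $\mathbb{Z}_n$ generated by $h$, then $rn_k(C_n) = \mathrm{LB}(n,k) + \left\lceil \frac{p}{2}\right\rceil - 1$.
   Context: $C_n$ is the cycle on vertex set $\mathbb{Z}_n$, with $u,v$ adjacent iff $u \equiv v \pm 1 \pmod n$; $d(u,v)$ is the graph distance. A radio-$k$-labeling of a graph $G$ is a function $f \colon V(G) \to \{0,1,2,\ldots\}$ with $|f(u)-f(v)| \geqslant k - d(u,v) + 1$ for all distinct $u,v$. The span of $f$ is $\max\{|f(u)-f(v)|\}$, and $rn_k(G)$ is the minimum span over radio-$k$-labelings of $G$. *)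

(* Defs.v *)
From mathcomp Require Import all_boot all_order all_algebra all_fingroup.
From mathcomp Require Import boolp.

Set Implicit Arguments.
Unset Strict Implicit.
Unset Printing Implicit Defensive.

Import Order.TTheory GRing.Theory Num.Theory.

(* Least length of a walk from x to y, a shortest walk in a finite graph having
   fewer than #|T| edges; the value is #|T| when y is not reachable from x. *)
Definition graph_dist (T : finType) (e : rel T) (x y : T) : nat :=
  find (fun m => [exists w : m.-tuple T, path e x w && (last x w == y)])
       (iota 0 #|T|).

(* The inequality is over int, so that k - d(u,v) + 1 is not truncated. *)
Definition radio_labeling (T : finType) (e : rel T) (k : nat) (f : T -> nat) :
    Prop :=
  forall u v : T, u != v ->
    (`|(f u)%:Z - (f v)%:Z| >= k%:Z - (graph_dist e u v)%:Z + 1)%R.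

Definition span (T : finType) (f : T -> nat) : nat :=
  \max_(u : T) \max_(v : T) `|((f u)%:Z - (f v)%:Z)%R|%N.

Lemma radio_labeling_exists (T : finType) (e : rel T) (k : nat) :
  exists s : nat,
    `[< exists f : T -> nat, radio_labeling e k f /\ span f = s >].
Proof.
pose f (x : T) := (enum_rank x * k.+1)%N.
exists (span f); apply/asboolP; exists f; split=> // u v neq_uv.
have H (i j : nat) : i != j ->
    (k.+1%:Z <= `|(i * k.+1)%:Z - (j * k.+1)%:Z|)%R.
  move=> neq_ij; rewrite !PoszM -mulrBl normrM.
  rewrite [X in (_ * X)%R]ger0_norm // ler_peMl //.
  by rewrite -gtz0_ge1 normr_gt0 subr_eq0 eqz_nat.
apply: le_trans (H (enum_rank u) (enum_rank v) _); last first.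
  by apply: contra neq_uv => /eqP/val_inj/enum_rank_inj ->.
by rewrite -addn1 PoszD lerD2r lerBlDr lerDl.
Qed.

Definition radio_number (T : finType) (e : rel T) (k : nat) : nat :=
  ex_minn (radio_labeling_exists e k).

(* 'Z_n has n elements only for n > 1. *)
Definition cycle_adj (n : nat) : rel 'Z_n :=
  fun u v => ((u == v + 1) || (u == v - 1))%R.

(* uphalf m is the ceiling of m / 2; for even n and n / 2 <= k neither
   subtraction involving k is truncated. *)
Definition LB (n k : nat) : nat :=
  uphalf (3 * k + 3 - n) * (n - 2)./2 + (k - n./2 + 1).

(* Main.v *)
(* Put n = 2m, so that k = n - 1 - 2h, and write phi = n - 3h.  List the vertices
   x_0, x_1, ... by increasing label.  The three pairwise distances of any three
   vertices sum to at most n, so f(x_(i+2)) - f(x_i) >= phi, and equality forces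
   d(x_i, x_(i+2)) = h, hence x_i = x_(i+2) modulo p.  Thus, up to the final or
   initial gap m - 2h, the excess of the span over LB bounds the number of
   changes of residue class modulo p, both among the even-indexed and among the
   odd-indexed vertices; together these meet all p classes.
   Conversely, take x_(2j) = jh + j/r and x_(2j+1) = x_(2j) + m, with labels
   j phi + j/r and j phi + j/r + m - 2h: each change of class costs exactly one.
   This enumerates the cycle for r = m/p when p divides m, and for r = n/p
   otherwise, where p | m is equivalent to m being in <h>. *)
Require Import Defs.
From mathcomp Require Import all_boot all_order all_algebra all_fingroup.
From mathcomp Require Import zify ring boolp.

(** * Distance in the cycle *)

(** One of the two truncated differences vanishes, so their sum is |a - b|; the minimum chooses the
    shorter arc. *)
Definition cyc_dist (n a b : nat) : nat :=
  minn (a - b + (b - a)) (n - (a - b + (b - a))).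

Lemma cyc_distC (n a b : nat) : cyc_dist n a b = cyc_dist n b a.
Proof. by rewrite /cyc_dist [a - b + _]addnC. Qed.

Lemma cyc_dist_triangle (n a b c : nat) : a < n -> b < n -> c < n ->
  cyc_dist n a c <= cyc_dist n a b + cyc_dist n b c.
Proof. by rewrite /cyc_dist; lia. Qed.

Lemma cycle_adjE (n : nat) (u v : 'I_n.+2) :
  @cycle_adj n.+2 u v = (cyc_dist n.+2 u v == 1).
Proof.
have succE (x y : 'I_n.+2) :
    (x == (y + 1)%R) = (x == y.+1 :> nat) || (x == 0 :> nat) && (y == n.+1 :> nat).
  rewrite -val_eqE /= modnDmr addn1; move: (ltn_ord x) (ltn_ord y).
  case: (eqVneq (y : nat) n.+1) => [->|neq_y] ltx lty; first by rewrite modnn; lia.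
  by rewrite modn_small; lia.
have predE : (u == (v - 1)%R) = (v == (u + 1)%R).
  by rewrite eq_sym GRing.subr_eq.
rewrite /cycle_adj predE !succE /cyc_dist.
by move: (ltn_ord u) (ltn_ord v); lia.
Qed.

(** By the triangle inequality a walk gains at most one per edge; conversely, stepping to a
    neighbour nearer to [v] builds a walk of exactly that length. *)
Lemma graph_dist_cycle (n : nat) (u v : 'Z_n) :
  1 < n -> graph_dist (@cycle_adj n) u v = cyc_dist n u v.
Proof.
case: n u v => [|[|n]] // u v _; change 'I_n.+2 in u, v.
have lower (w : seq 'I_n.+2) (x : 'I_n.+2) :
    path (@cycle_adj n.+2) x w -> cyc_dist n.+2 x (last x w) <= size w.
  elim: w x => [|z w IHw] x /=; first by rewrite /cyc_dist; lia.
  rewrite cycle_adjE => /andP[/eqP xz /IHw zw].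
  have := cyc_dist_triangle _ _ _ _ (ltn_ord x) (ltn_ord z) (ltn_ord (last z w)).
  by rewrite xz add1n => /leq_trans; apply.
have upper d (x : 'I_n.+2) : cyc_dist n.+2 x v = d ->
    exists w : d.-tuple 'I_n.+2, path (@cycle_adj n.+2) x w && (last x w == v).
  elim: d x => [|d IHd] x xv.
    exists [tuple]; rewrite /= -val_eqE /=; move: xv (ltn_ord x) (ltn_ord v).
    by rewrite /cyc_dist; lia.
  have [z xz zv] : exists2 z : 'I_n.+2, cyc_dist n.+2 x z = 1 &
                                        cyc_dist n.+2 z v = d.
    have ltx := ltn_ord x; have ltv := ltn_ord v.
    have step (z : nat) : z < n.+2 -> cyc_dist n.+2 x z = 1 -> cyc_dist n.+2 z v = d ->
      exists2 z : 'I_n.+2, cyc_dist n.+2 x z = 1 & cyc_dist n.+2 z v = d.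
      by move=> ltz xz zv; exists (Ordinal ltz).
    (* The two neighbours of [x], with wraparound; at least one of them is nearer to [v]. *)
    pose up := if x == n.+1 :> nat then 0 else x.+1.
    pose down := if x == 0 :> nat then n.+1 else x.-1.
    have [e|ne] := eqVneq (cyc_dist n.+2 up v) d.
      by apply: (step up) => //; rewrite /up /cyc_dist; case: (x =P n.+1 :> nat); lia.
    apply: (step down); move: ne xv; rewrite /up /down /cyc_dist;
      by case: (x =P n.+1 :> nat) => ?; case: (x =P 0 :> nat) => ?; lia.
  have [w /andP[pw lw]] := IHd z zv.
  by exists [tuple of z :: w]; rewrite /= cycle_adjE xz pw lw.
rewrite /graph_dist card_ord; set P := (fun m => _).
have PD : P (cyc_dist n.+2 u v) by apply/existsP; apply: upper.
have Dn : cyc_dist n.+2 u v < n.+2.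
  by move: (ltn_ord u) (ltn_ord v); rewrite /cyc_dist; lia.
have hasP_ : has P (iota 0 n.+2).
  by apply/hasP; exists (cyc_dist n.+2 u v); rewrite ?mem_iota.
apply/eqP; rewrite eqn_leq; apply/andP; split.
  rewrite leqNgt; apply/negP => /(before_find 0).
  by rewrite nth_iota // PD.
have := nth_find 0 hasP_; rewrite has_find size_iota in hasP_.
rewrite nth_iota // add0n => /existsP[w /andP[pw /eqP lw]].
by rewrite -[X in _ <= X](size_tuple w) -lw; apply: lower.
Qed.

(** * Radio number and span *)

Lemma radio_numberP (T : finType) (e : rel T) (k : nat) :
  (exists2 f, radio_labeling e k f & Defs.span f = radio_number e k) /\
  forall f, radio_labeling e k f -> radio_number e k <= Defs.span f.
Proof.
rewrite /radio_number; case: ex_minnP => s /asboolP[f [rf sf]] smin; split.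
  by exists f.
by move=> g rg; apply: smin; apply/asboolP; exists g.
Qed.

Lemma leq_span (T : finType) (f : T -> nat) (u v : T) : f u - f v <= Defs.span f.
Proof.
rewrite /Defs.span; apply: leq_trans (leq_bigmax u); apply: leq_trans (leq_bigmax v).
lia.
Qed.

Lemma span_leq (T : finType) (f : T -> nat) (s : nat) :
  (forall u, f u <= s) -> Defs.span f <= s.
Proof.
move=> fs; rewrite /Defs.span; apply/bigmax_leqP => u _; apply/bigmax_leqP => v _.
by move: (fs u) (fs v); lia.
Qed.

(** * Lower bound *)

(* The total excess over [N * phi] pays for every new residue class met. *)
Lemma count_classes (y G : nat -> nat) (p phi N : nat) :
  (forall i, i < N -> G i + phi + (y i != y i.+1 %[mod p]) <= G i.+1) ->
  G 0 + N * phi + size (undup (mkseq (fun i => y i %% p) N.+1)) <= G N + 1.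
Proof.
elim: N => [|N IHN] step; first by rewrite /=; lia.
have {IHN} := IHN (fun i ltiN => step i (ltnW ltiN)).
have := step N (leqnn _).
set z := fun i => _.
(* A term in the class of its predecessor adds no residue. The initial class is free, whence the
   [+ 1] in the conclusion. *)
have sub : size (undup (mkseq z N.+2)) <=
    size (undup (mkseq z N.+1)) + (y N != y N.+1 %[mod p]).
  have [eqy|ney] := eqVneq (y N %% p) (y N.+1 %% p).
    rewrite addn0; apply: uniq_leq_size (undup_uniq _) _ => t.
    rewrite !mem_undup => /mapP[i]; rewrite mem_iota => /andP[_ ltiN] ->.
    have [->|neq] := eqVneq i N.+1.
      by rewrite /z -eqy; apply/mapP; exists N; rewrite // mem_iota; lia.
    by apply: map_f; rewrite mem_iota; lia.
  rewrite addn1; apply: (@uniq_leq_size _ _ (z N.+1 :: _) (undup_uniq _)) => t.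
  rewrite in_cons !mem_undup => /mapP[i]; rewrite mem_iota => /andP[_ ltiN] ->.
  have [->|neq] := eqVneq i N.+1; first by rewrite eqxx.
  by apply/orP; right; apply: map_f; rewrite mem_iota; lia.
by rewrite mulSn; lia.
Qed.

(** The distance is a - b up to sign modulo [n], hence also modulo the divisor [p]. *)
Lemma cyc_dist_mod (n p a b : nat) : a < n -> b < n -> p %| n ->
  p %| cyc_dist n a b -> a = b %[mod p].
Proof.
move=> ltan ltbn pn pd; apply/eqP.
wlog le_ab : a b ltan ltbn pd / a <= b => [wlg|].
  have [/wlg|/ltnW/wlg] := leqP a b; first exact.
  by rewrite eq_sym; apply=> //; rewrite cyc_distC.
rewrite eq_sym eqn_mod_dvd //; move: pd; rewrite /cyc_dist.
have -> : a - b + (b - a) = b - a by lia.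
by rewrite /minn; case: ifP => // _; rewrite dvdn_subr //; lia.
Qed.

(** Three points cut the cycle into arcs of total length [n], and each distance is at most the
    matching arc. *)
Lemma cyc_dist_perimeter (n a b c : nat) : a < n -> b < n -> c < n ->
  cyc_dist n a b + cyc_dist n b c + cyc_dist n a c <= n.
Proof.
move=> lta ltb ltc.
have lel x y : cyc_dist n x y <= x - y + (y - x) by exact: geq_minl.
have ler x y : cyc_dist n x y <= n - (x - y + (y - x)) by exact: geq_minr.
move: (lel a b) (lel b c) (lel a c) (ler a b) (ler b c) (ler a c).
move: (cyc_dist n a b) (cyc_dist n b c) (cyc_dist n a c) => ab bc ac {lel ler}.
by case: (leqP a b) => ?; case: (leqP b c) => ?; case: (leqP a c) => ?; lia.
Qed.

(** Here [2 * m - 2 * h] is k + 1. The three inequalities and the perimeter bound add up to fc - fa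
    >= 2m - 3h. Under equality the third gives d(a, c) >= h, and the first two with the perimeter
    bound give d(a, c) <= h; so [p] divides d(a, c). *)
Lemma gap2_lower (m h p a b c fa fb fc : nat) :
  2 * h < m -> p %| 2 * m -> p %| h ->
  a < 2 * m -> b < 2 * m -> c < 2 * m ->
  fa + (2 * m - 2 * h) <= fb + cyc_dist (2 * m) a b ->
  fb + (2 * m - 2 * h) <= fc + cyc_dist (2 * m) b c ->
  fa + (2 * m - 2 * h) <= fc + cyc_dist (2 * m) a c ->
  fa + (2 * m - 3 * h) + (a != c %[mod p]) <= fc.
Proof.
move=> hm pn ph lta ltb ltc ab bc ac.
have tri : cyc_dist (2 * m) a b + cyc_dist (2 * m) b c + cyc_dist (2 * m) a c <= 2 * m.
  exact: cyc_dist_perimeter.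
have [_|ne] := eqVneq (a %% p) (c %% p); first by lia.
have : cyc_dist (2 * m) a c != h.
  by apply: contraNneq ne => dh; apply/eqP/(@cyc_dist_mod (2 * m)); rewrite ?dh.
move: ab bc ac tri; rewrite {pn ph ne} /=.
move: (cyc_dist _ a b) (cyc_dist _ b c) (cyc_dist _ a c) => *; lia.
Qed.

Lemma radio_seq_lower (m h : nat) (x F : nat -> nat) :
  2 * h < m ->
  (forall i, i < 2 * m -> x i < 2 * m) ->
  (forall c, c < 2 * m -> exists2 i, i < 2 * m & x i = c) ->
  (forall i j, i < j -> j < 2 * m ->
     F i + (2 * m - 2 * h) <= F j + cyc_dist (2 * m) (x i) (x j)) ->
  F 0 + (m - 1) * (2 * m - 3 * h) + (m - 2 * h) + uphalf (gcdn (2 * m) h)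
    <= F (2 * m - 1) + 1.
Proof.
move=> hm ltx surjx radio; set p := gcdn (2 * m) h; set phi := 2 * m - 3 * h.
have step i : i.+2 < 2 * m -> F i + phi + (x i != x i.+2 %[mod p]) <= F i.+2.
  move=> lti; apply: (@gap2_lower m h p _ (x i.+1) _ _ (F i.+1)) => //;
    rewrite ?dvdn_gcdl ?dvdn_gcdr //; (apply: ltx || apply: radio); lia.
(* No distance exceeds [m], half the cycle. *)
have consec i : i.+1 < 2 * m -> F i + (m - 2 * h) <= F i.+1.
  move=> lti; have := radio i i.+1 (leqnn _) lti.
  by move: (ltx i (ltnW lti)) (ltx _ lti); rewrite /cyc_dist; lia.
have m0 : 0 < m by lia.
have even := @count_classes (fun i => x i.*2) (fun i => F i.*2) p phi (m - 1).
have {even} := even (fun i lti => step i.*2 ltac:(lia)).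
have odd := @count_classes (fun i => x i.*2.+1) (fun i => F i.*2.+1) p phi (m - 1).
have {odd} := odd (fun i lti => step i.*2.+1 ltac:(lia)).
set so := undup _; set se := undup _.
(* Each residue below [p] is itself a vertex, listed at an even or an odd position. *)
have cover : p <= size se + size so.
  rewrite -size_cat -(size_iota 0 p); apply: uniq_leq_size (iota_uniq _ _) _ => c.
  rewrite mem_iota add0n => /andP[_ ltcp]; rewrite mem_cat !mem_undup.
  have [i lti xi] : exists2 i, i < 2 * m & x i = c.
    by apply: surjx; apply: leq_trans ltcp (dvdn_leq _ (dvdn_gcdl _ _)); lia.
  have modc : c = x i %% p by rewrite xi modn_small.
  have := odd_double_half i; case: (boolP (odd i)) => _ ei; apply/orP.
    by right; apply/mapP; exists i./2; rewrite ?mem_iota; [lia | rewrite modc -{1}ei].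
  by left; apply/mapP; exists i./2; rewrite ?mem_iota; [lia | rewrite modc -{1}ei].
(* The last gap extends the even chain and the first gap the odd one, so both bound the same
   difference; the larger class count is at least [uphalf p]. *)
have := consec 0 ltac:(lia); have := consec (2 * m - 2) ltac:(lia).
have -> : (2 * m - 2).+1 = 2 * m - 1 by lia.
have -> : (m - 1).*2.+1 = 2 * m - 1 by lia.
have -> : (m - 1).*2 = 2 * m - 2 by lia.
by rewrite double0; move: (size se) (size so) cover ((m - 1) * phi) => e o cover M; lia.
Qed.

Lemma card_Zn (n : nat) : 1 < n -> #|{: 'Z_n}| = n.
Proof. by move=> n1; rewrite card_ord Zp_cast. Qed.

Lemma ltn_Zn (n : nat) (u : 'Z_n) : 1 < n -> u < n.
Proof. by move=> n1; have := ltn_ord u; rewrite [X in _ < X]Zp_cast. Qed.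

Lemma natr_Zn (n c : nat) : c < n -> 1 < n -> (c%:R%R : 'Z_n) = c :> nat.
Proof. by move=> ltc n1; rewrite val_Zp_nat // modn_small. Qed.

(** Sorting the vertices by an optimal labeling yields a sequence as in [radio_seq_lower]. *)
Lemma radio_number_lower (m h : nat) : 2 * h < m ->
  (m - 1) * (2 * m - 3 * h) + (m - 2 * h) + uphalf (gcdn (2 * m) h) - 1
    <= radio_number (@cycle_adj (2 * m)) (2 * m - 1 - 2 * h).
Proof.
move=> hm; have n1 : 1 < 2 * m by lia.
have [[f rf <-] _] := radio_numberP _ (@cycle_adj (2 * m)) (2 * m - 1 - 2 * h).
pose s := sort (relpre f leq) (enum 'Z_(2 * m)).
have size_s : size s = 2 * m by rewrite size_sort -cardE card_Zn.
have sorted_s : sorted (relpre f leq) s.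
  by apply: sort_sorted => u v; apply: leq_total.
have uniq_s : uniq s by rewrite sort_uniq enum_uniq.
pose x i := nth 0%R s i.
have radio_x i j : i < j -> j < 2 * m ->
    f (x i) + (2 * m - 2 * h) <= f (x j) + cyc_dist (2 * m) (x i) (x j).
  move=> ltij ltj; have lti := ltn_trans ltij ltj.
  have neq : x i != x j by rewrite nth_uniq ?size_s // ltn_eqF.
  have le_f : f (x i) <= f (x j).
    have tr : transitive (relpre f leq) by move=> ? ? ?; apply: leq_trans.
    have re : reflexive (relpre f leq) by move=> ?; apply: leqnn.
    apply: (sorted_leq_nth tr re 0%R sorted_s); rewrite ?inE ?size_s //.
    exact: ltnW.
  have := rf _ _ neq; rewrite graph_dist_cycle //.
  move: (f (x i)) (f (x j)) le_f (cyc_dist _ _ _) => a b le_ab d.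
  by lia.
have x_surj c : c < 2 * m -> exists2 i, i < 2 * m & x i = c :> nat.
  move=> ltc; exists (index (c%:R%R : 'Z_(2 * m)) s).
    by rewrite -[X in _ < X]size_s index_mem mem_sort mem_enum.
  by rewrite /x nth_index ?mem_sort ?mem_enum //; exact: natr_Zn.
have := @radio_seq_lower m h (fun i => x i) (fun i => f (x i)) hm
  (fun i _ => ltn_Zn _ (x i) n1) x_surj radio_x.
have := leq_span _ f (x (2 * m - 1)) (x 0).
by move: ((m - 1) * _) (uphalf _) => M p; lia.
Qed.

(** * Upper bound: the explicit labeling *)

(** With i = 2j + b, the summand [i./2 %/ r] is the number of the block of [r] consecutive j; it
    shifts the multiples of [h] to another coset when a block ends. *)
Definition vertex (m h r i : nat) : nat :=
  (i./2 * h + i./2 %/ r + odd i * m) %% (2 * m).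

Definition label (m h r i : nat) : nat :=
  i./2 * (2 * m - 3 * h) + i./2 %/ r + odd i * (m - 2 * h).

Lemma cyc_dist_addmod (n a t : nat) : t <= n ->
  cyc_dist n (a %% n) ((a + t) %% n) = minn t (n - t).
Proof.
have [->|n0] := posnP n; first by rewrite /cyc_dist leqn0 => /eqP->; lia.
rewrite leq_eqVlt => /predU1P[->|lt_tn].
  by rewrite modnDr /cyc_dist; lia.
rewrite -modnDml; have := ltn_pmod a n0; move: (a %% n) => b ltb.
have [lt|ge] := ltnP (b + t) n; first by rewrite modn_small // /cyc_dist; lia.
have -> : (b + t) %% n = b + t - n by rewrite -{1}(subnK ge) modnDr modn_small; lia.
by rewrite /cyc_dist; lia.
Qed.

Lemma label_gap (m h r i j : nat) : 2 * h < m -> 0 < r -> i < j ->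
  label m h r i + (2 * m - 2 * h) <=
    label m h r j + cyc_dist (2 * m) (vertex m h r i) (vertex m h r j).
Proof.
move=> hm r0 ltij.
have lab_mono a : (a.+1 %/ r = a %/ r) \/ (a.+1 %/ r = (a %/ r).+1).
  by rewrite divnS //; case: (r %| _); [right|left].
have half_le : i./2 <= j./2 by lia.
have [d jd] : exists d, j./2 = i./2 + d by exists (j./2 - i./2); lia.
(* Halves differing by at most one need exact distances. *)
case: d jd => [|[|d]] jd.
- have [oi oj] : odd i = false /\ odd j = true by split; lia.
  rewrite /label /vertex oi oj jd addn0 mul0n mul1n !addn0.
  by rewrite cyc_dist_addmod; lia.
- rewrite addn1 in jd; have [eps [eps1 eq_eps]] : exists eps, eps <= 1 /\ j./2 %/ r = i./2 %/ r + eps.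
    by rewrite jd; case: (lab_mono i./2) => ->; [exists 0|exists 1]; lia.
  rewrite /label /vertex eq_eps jd !mulSn; move: (i./2 * _) (i./2 * h) (i./2 %/ r).
  move=> M A B.
  case: (odd i); case: (odd j); rewrite ?mul0n ?mul1n ?addn0.
  + have -> : h + A + (B + eps) + m = A + B + m + (h + eps) by lia.
    by rewrite cyc_dist_addmod; lia.
  (* Only vertex [i] carries the summand [m], so it lies ahead, at distance [m - h - eps]; the label
     gap is m - h + eps and the bound is attained. *)
  + have -> : A + B + m = h + A + (B + eps) + (m - h - eps) by lia.
    by rewrite cyc_distC cyc_dist_addmod; lia.
  + have -> : h + A + (B + eps) + m = A + B + (m + h + eps) by lia.
    by rewrite cyc_dist_addmod; lia.
  + have -> : h + A + (B + eps) = A + B + (h + eps) by lia.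
    by rewrite cyc_dist_addmod; lia.
(* From two halves apart, the label gap is at least 2(2m - 3h) - (m - 2h) = 3m - 4h, which suffices
   without any distance. *)
have div_le : i./2 %/ r <= j./2 %/ r by exact: leq_div2r.
rewrite /label jd mulnDl !mulSn -jd; move: (i./2 * _) (d * _) (cyc_dist _ _ _) => M D c.
by case: (odd i); case: (odd j); lia.
Qed.

Lemma radio_number_upper (m h r : nat) : 2 * h < m -> 0 < r ->
  {in gtn (2 * m) &, injective (vertex m h r)} ->
  radio_number (@cycle_adj (2 * m)) (2 * m - 1 - 2 * h)
    <= (m - 1) * (2 * m - 3 * h) + (m - 2 * h) + (m - 1) %/ r.
Proof.
move=> hm r0 inj; have n1 : 1 < 2 * m by lia.
have n0 : 0 < 2 * m by lia.
pose x (i : 'I_(2 * m)) : 'Z_(2 * m) := (vertex m h r i)%:R%R.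
have xE i : x i = vertex m h r i :> nat.
  by apply: natr_Zn; rewrite // ltn_pmod.
have [g xg gx] : bijective x.
  apply: inj_card_bij; last by rewrite card_Zn // card_ord.
  by move=> i j /(congr1 val) /=; rewrite !xE => /inj/val_inj; apply; exact: ltn_ord.
pose f u := label m h r (g u).
have [_ /(_ f) low] := radio_numberP _ (@cycle_adj (2 * m)) (2 * m - 1 - 2 * h).
apply: leq_trans (low _) _.
  move=> u v neq; rewrite graph_dist_cycle // -(gx u) -(gx v) !xE /f !xg.
  have : g u != g v by rewrite (can_eq gx).
  rewrite -val_eqE neq_ltn /= => /orP[] lt; have := label_gap m h r _ _ hm r0 lt;
    rewrite 1?[cyc_dist _ _ (vertex _ _ _ (g u))]cyc_distC;
    move: (label _ _ _ _) (label _ _ _ _) (cyc_dist _ _ _) => a b d; lia.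
apply: span_leq => u; rewrite /f /label; have := ltn_ord (g u).
move: (g u : nat) => i lti.
(* Each summand of the label is largest at the last index 2m - 1. *)
have le_half : i./2 <= m - 1 by lia.
have := leq_mul2r (2 * m - 3 * h) i./2 (m - 1); rewrite le_half orbT.
have := leq_div2r r le_half.
move: (i./2 * _) ((m - 1) * _) => M N.
by case: (odd i); lia.
Qed.

(** * Injectivity of the enumeration *)

Lemma eqn_mod_cancel (d r c a b : nat) : 0 < d -> coprime r c ->
  a * (d * c) = b * (d * c) %[mod d * r] -> a = b %[mod r].
Proof.
move=> d0 co /eqP eqab; apply/eqP.
wlog le_ab : a b eqab / b <= a => [wlg|].
  have [le|/ltnW le] := leqP b a; first exact: wlg.
  by rewrite eq_sym wlg // eq_sym.
move: eqab; rewrite !eqn_mod_dvd ?leq_mul2r ?le_ab ?orbT // -mulnBl mulnCA.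
by rewrite dvdn_pmul2l // Gauss_dvdl.
Qed.

Lemma eqn_div_mod (r a b : nat) : a %/ r = b %/ r -> a = b %[mod r] -> a = b.
Proof. by move=> ed em; rewrite (divn_eq a r) (divn_eq b r) ed em. Qed.

Lemma half_ltn (m i : nat) : i < 2 * m -> i./2 < m.
Proof. lia. Qed.

Lemma odd_half_inj (i j : nat) : odd i = odd j -> i./2 = j./2 -> i = j.
Proof. lia. Qed.

(** Here the gcd of [h] and 2m is [2 * p]. As [r] is odd, [p * r] is [p] modulo [2 * p], so a vertex
    reduces to block number plus [b * p]. Block numbers are below [p], hence both block and parity
    are recovered; cancelling [2 * p * c] gives the place in the block. *)
Lemma vertex_inj_odd (p r c : nat) : 0 < p -> odd r -> coprime r c ->
  {in gtn (2 * (p * r)) &, injective (vertex (p * r) (2 * p * c) r)}.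
Proof.
move=> p0 odd_r co i j /half_ltn + /half_ltn; rewrite /vertex [2 * (p * r)]mulnA.
move=> lti ltj eqv; have r0 := odd_gt0 odd_r.
have pr_mod (b : bool) : b * (p * r) = b * p %[mod 2 * p].
  have -> : p * r = r./2 * (2 * p) + p.
    have {1}<- : 1 + 2 * r./2 = r.
      by rewrite mul2n -[RHS]odd_double_half odd_r.
    by ring.
  by rewrite mulnDr (mulnA b) modnMDl.
have red a (b : bool) : (a * (2 * p * c) + a %/ r + b * (p * r)) %% (2 * p * r) %% (2 * p)
    = (a %/ r + b * p) %% (2 * p).
  rewrite (modn_dvdm _ (dvdn_mulr _ (dvdnn _))) [2 * p * c]mulnC mulnA -addnA modnMDl.
  by rewrite -modnDmr pr_mod modnDmr.
have small a (b : bool) : a < p * r -> a %/ r + b * p < 2 * p.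
  by rewrite -ltn_divLR // => {eqv}; move: (a %/ r) => x; case: b; lia.
have := congr1 (modn^~ (2 * p)) eqv.
rewrite !red !modn_small ?small // => eqd.
have [eqo eq_div] : odd i = odd j /\ i./2 %/ r = j./2 %/ r.
  move: lti ltj eqd => {eqv}; rewrite -!ltn_divLR //.
  move: (_ %/ r) (_ %/ r) => x y.
  by case: (odd i); case: (odd j); lia.
apply: odd_half_inj => //; apply: eqn_div_mod (eq_div) _.
apply: (@eqn_mod_cancel (2 * p) r c) => //; first by rewrite muln_gt0.
by apply/eqP; move/eqP: eqv; rewrite eqo eq_div !eqn_modDr.
Qed.

(** Reduction modulo [p] recovers the block number, reduction modulo [p * r] the place in the block,
    and then the parity remains, as [p * r] is nonzero modulo its double. *)
Lemma vertex_inj_dvd (p r c : nat) : 0 < p -> 0 < r -> coprime r c ->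
  {in gtn (2 * (p * r)) &, injective (vertex (p * r) (p * c) r)}.
Proof.
move=> p0 r0 co i j /half_ltn + /half_ltn; rewrite /vertex.
move=> lti ltj eqv.
have red a (b : bool) : (a * (p * c) + a %/ r + b * (p * r)) %% (2 * (p * r)) %% p
    = (a %/ r) %% p.
  rewrite (modn_dvdm _ (dvdn_mull _ (dvdn_mulr _ (dvdnn _)))) [p * c]mulnC mulnA -addnA modnMDl.
  by rewrite [p * r]mulnC mulnA addnC modnMDl.
have eq_div : i./2 %/ r = j./2 %/ r.
  have := congr1 (modn^~ p) eqv.
  by rewrite !red !modn_small // ltn_divLR.
have eq_half : i./2 = j./2.
  apply: eqn_div_mod (eq_div) _; apply: (@eqn_mod_cancel p r c) => //; apply/eqP.
  have := congr1 (modn^~ (p * r)) eqv; rewrite !(modn_dvdm _ (dvdn_mull _ (dvdnn _))).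
  by rewrite ![_ + _ * (p * r)]addnC !modnMDl eq_div => /eqP; rewrite eqn_modDr.
apply: odd_half_inj => //; move: eqv; rewrite eq_half => /eqP; rewrite eqn_modDl.
have pr0 : p * r < 2 * (p * r) by rewrite ltn_Pmull // muln_gt0 p0.
case: (odd i); case: (odd j); rewrite // ?mul1n ?mul0n mod0n modn_small //.
all: by move: p0 r0; case: p {co red eq_div eq_half pr0 lti ltj} => // p; case: r.
Qed.

(** * Closed form of the bound, and conclusion *)

(** With k + 1 = 2m - 2h, the number 3k + 3 - n is 2(2m - 3h), so the ceiling is exact. *)
Lemma LB_eq (m h : nat) : 2 * h < m ->
  LB (2 * m) (2 * m - 1 - 2 * h) = (m - 1) * (2 * m - 3 * h) + (m - 2 * h).
Proof.
move=> hm; rewrite /LB mulnC; congr (_ * _ + _); lia.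
Qed.

(** By Bezout the gcd is a multiple of [h] modulo [n]. *)
Lemma mem_cycle_Zn (n h m : nat) : 1 < n -> 0 < h -> gcdn n h %| m ->
  (m%:R%R : 'Z_n) \in <[(h%:R%R : 'Z_n)]>%g.
Proof.
move=> n1 h0 /dvdnP[q ->]; have [u v uv _] := egcdnP n h0.
suff -> : (q * gcdn n h)%:R%R = (h%:R *+ (u * q))%R :> 'Z_n.
  by rewrite Zp_mulrn -Zp_expg; apply: mem_cycle.
rewrite -GRing.mulrnA mulnA [h * u]mulnC uv mulnDl GRing.natrD.
have -> : (v * n * q)%:R%R = 0%R :> 'Z_n.
  by rewrite mulnAC GRing.natrM pchar_Zp // GRing.mulr0.
by rewrite GRing.add0r gcdnC mulnC.
Qed.

Theorem theorem4p3 (n k : nat)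
    (n_even : ~~ odd n) (k_odd : odd k) (k_ge : n./2 <= k) (k_lt : k < n - 3) :
  let h := (n - k - 1)./2 in
  let p := gcdn n h in
  (LB n k + uphalf p - 1 <= radio_number (@cycle_adj n) k <= LB n k + p - 1)
  /\ ((n./2%:R%R : 'Z_n) \notin <[(h%:R%R : 'Z_n)]>%g ->
      radio_number (@cycle_adj n) k = LB n k + uphalf p - 1).
Proof.
move=> h p.
have [m nE] : exists m, n = 2 * m by exists n./2; lia.
have kE : k = 2 * m - 1 - 2 * h by rewrite /h; lia.
have hm : 2 * h < m by rewrite /h; lia.
have h0 : 0 < h by rewrite /h; lia.
move: @p; rewrite kE; move: h hm h0 {kE k_odd k_ge k_lt} => h hm h0.
have -> : n./2 = m by lia.
move: nE n_even => -> _ p.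
have p0 : 0 < p by rewrite gcdn_gt0 h0 orbT.
have low := radio_number_lower m h hm.
rewrite LB_eq //; rewrite -/p in low.
have [a nE] : exists a, 2 * m = p * a.
  by have /dvdnP[a ->] := dvdn_gcdl (2 * m) h; exists a; rewrite mulnC.
have [c hE] : exists c, h = p * c.
  by have /dvdnP[c ->] := dvdn_gcdr (2 * m) h; exists c; rewrite mulnC.
have co : coprime a c.
  have : p * gcdn a c = p * 1 by rewrite muln_gcdr -nE -hE muln1.
  by move/eqP; rewrite eqn_pmul2l // /coprime.
have m0 : 0 < m by lia.
have n1 : 1 < 2 * m by lia.
(* If [p] divides [m], then [m] lies in the subgroup generated by [h] and the second claim is
   vacuous; r = m/p gives at most p - 1 class changes. *)
have [pm|ndvd] := boolP (p %| m).
  have /dvdnP[r mE] := pm.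
  have r0 : 0 < r by case: r mE => // mE; lia.
  split; last by rewrite mem_cycle_Zn.
  rewrite low /=.
  have aE : a = 2 * r.
    by apply/eqP; rewrite -(eqn_pmul2l p0) -nE mE; apply/eqP; lia.
  have inj : {in gtn (2 * m) &, injective (vertex m h r)}.
    rewrite hE mE [r * p]mulnC; apply: vertex_inj_dvd => //.
    by move: co; rewrite aE coprimeMl => /andP[].
  apply: leq_trans (radio_number_upper m h r hm r0 inj) _.
  have : (m - 1) %/ r < p by rewrite ltn_divLR // mulnC -mE; lia.
  by move: ((m - 1) %/ r) ((m - 1) * _) => D M; lia.
(* An even [a] would give m = p(a/2). So [p] is even, and blocks of length [a] leave at most p/2 - 1
   changes, which meets the lower bound. *)
have odd_a : odd a.
  apply: contraR ndvd => ea; apply/dvdnP; exists a./2; nia.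
have [p' pE] : exists p', p = 2 * p'.
  by exists p./2; have := congr1 odd nE; rewrite !oddM odd_a; lia.
have mE : m = p' * a by nia.
have inj : {in gtn (2 * m) &, injective (vertex m h a)}.
  by rewrite hE mE pE; apply: vertex_inj_odd => //; lia.
have up := radio_number_upper m h a hm (odd_gt0 odd_a) inj.
have : (m - 1) %/ a < p' by rewrite ltn_divLR ?odd_gt0 // -mE; lia.
have upE : uphalf p = p' by rewrite pE; lia.
rewrite upE in low *.
by move: low up; move: ((m - 1) %/ a) ((m - 1) * _) => D M *; split; lia.
Qed.
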